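(* Let $\Gamma$ be a finitely presented group and let $\Lambda$ be a finitely generated commensurated subgroup of $\Gamma$. Then the totally disconnected locally compact group $\Gamma /\!\!/ \Lambda$ (the Schlichting completion of $\Gamma$ with respect to $\Lambda$) is compactly presented.
   Context: A subgroup $\Lambda$ of $\Gamma$ is commensurated if for every $\gamma\in\Gamma$ the subgroup $\gamma\Lambda\gamma^{-1}\cap\Lambda$ has finite index in both $\Lambda$ and $\gamma\Lambda\gamma^{-1}$. The Schlichting completion $\Gamma/\!\!/\Lambda$ is the closure of the image of $\Gamma$ in $\mathrm{Sym}(\Gamma/\Lambda)$ under the homomorphism $\Gamma\to\mathrm{Sym}(\Gamma/\Lambda)$ given by the left action on the coset space, where $\mathrm{Sym}(\Gamma/\Lambda)$ has the topology of pointwise convergence. When $\Lambda$ is commensurated, $\Gamma/\!\!/\Lambda$ is a totally disconnected locally compact group in which the closure of the image of $\Lambda$ is a compact open subgroup. A locally compact group $G$ is compactly presented if it has a compact generating subset $S$ such that $G$ has a presentation, as an abstract group, with $S$ as set of generators and relators of bounded length. *)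

(* Defs.v *)
From HB Require Import structures.
From mathcomp Require Import all_boot.
From mathcomp Require Import all_classical topology.

Set Implicit Arguments.
Unset Strict Implicit.
Unset Printing Implicit Defensive.

Local Open Scope classical_set_scope.
Local Open Scope group_scope.
Local Open Scope quotient_scope.

Section Subgroups.
Context {G : groupType}.
Implicit Types (A H K : set G) (g : G).

Definition subgroup H : Prop := group_closed (mem H).

Definition normal_subgroup H : Prop :=
  subgroup H /\ forall g x, H x -> H (g * x * g^-1).

Definition generated A : set G := smallest subgroup A.

Definition normal_closure A : set G := smallest normal_subgroup A.

Definition finitely_generated H : Prop :=
  exists2 A, finite_set A & H = generated A.

Definition lcoset g A : set G := [set g * x | x in A].

Definition conj_set g A : set G := [set g * x * g^-1 | x in A].

(* Intended for [K `<=` H]. *)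
Definition finite_index K H : Prop := finite_set [set lcoset h K | h in H].

Definition commensurated H : Prop := forall g,
  finite_index (conj_set g H `&` H) H /\
  finite_index (conj_set g H `&` H) (conj_set g H).

End Subgroups.

Section FreeGroup.
Context {X : choiceType}.

(* The letter [(x, false)] stands for x and [(x, true)] for its inverse. *)
Definition word : Type := seq (X * bool).
Implicit Types u v w : word.

Inductive free_equiv : word -> word -> Prop :=
| free_equiv_refl u : free_equiv u u
| free_equiv_sym u v : free_equiv u v -> free_equiv v u
| free_equiv_trans u v w : free_equiv u v -> free_equiv v w -> free_equiv u w
| free_equiv_cancel u v (x : X) (b : bool) :
    free_equiv (u ++ (x, b) :: (x, ~~ b) :: v) (u ++ v).

Definition free_rel : rel word := fun u v => `[< free_equiv u v >].

Fact free_rel_refl : reflexive free_rel.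
Proof. by move=> u; apply/asboolP/free_equiv_refl. Qed.

Fact free_rel_sym : symmetric free_rel.
Proof.
by move=> u v; apply/asboolP/asboolP; exact: free_equiv_sym.
Qed.

Fact free_rel_trans : transitive free_rel.
Proof.
move=> v u w /asboolP uv /asboolP vw; apply/asboolP.
exact: free_equiv_trans uv vw.
Qed.

Canonical free_rel_equiv :=
  EquivRel free_rel free_rel_refl free_rel_sym free_rel_trans.

Definition free_group : Type := {eq_quot free_rel}.
HB.instance Definition _ := Choice.on free_group.
HB.instance Definition _ := EqQuotient.on free_group.

Definition word_inv w : word := rev [seq (l.1, ~~ l.2) | l <- w].

Definition word_class w : free_group := \pi_free_group w.

Lemma word_classP u v : word_class u = word_class v <-> free_equiv u v.
Proof.
by split=> [/eqmodP/asboolP//|uv]; apply/eqmodP/asboolP.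
Qed.

Lemma free_equiv_cat u u' v v' :
  free_equiv u u' -> free_equiv v v' -> free_equiv (u ++ v) (u' ++ v').
Proof.
move=> uu' vv'; apply: (@free_equiv_trans _ (u' ++ v)).
  elim: uu' => {u u'} [u|u u' _ IH|u u' w _ IH1 _ IH2|u w x b].
  - exact: free_equiv_refl.
  - exact: free_equiv_sym.
  - exact: free_equiv_trans IH1 IH2.
  - by rewrite -!catA; exact: free_equiv_cancel.
elim: vv' => {v v'} [v|v v' _ IH|v v' w _ IH1 _ IH2|v w x b].
- exact: free_equiv_refl.
- exact: free_equiv_sym.
- exact: free_equiv_trans IH1 IH2.
- by rewrite !catA; exact: free_equiv_cancel.
Qed.

Lemma free_equiv_inv u v :
  free_equiv u v -> free_equiv (word_inv u) (word_inv v).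
Proof.
elim=> {u v} [u|u v _|u v w _ + _|u w x b].
- exact: free_equiv_refl.
- exact: free_equiv_sym.
- exact: free_equiv_trans.
rewrite /word_inv !map_cat/= !rev_cat !rev_cons negbK -!cats1 -!catA /=.
exact: free_equiv_cancel.
Qed.

Lemma word_invl w : free_equiv (word_inv w ++ w) [::].
Proof.
elim: w => [|[x b] w IH]; first exact: free_equiv_refl.
apply: free_equiv_trans IH.
rewrite /word_inv /= rev_cons -cats1 -catA /= -{2}[b]negbK.
exact: free_equiv_cancel.
Qed.

Lemma word_invK : involutive word_inv.
Proof.
move=> w; rewrite /word_inv map_rev revK -map_comp -[RHS]map_id.
by apply: eq_map => -[x b] /=; rewrite negbK.
Qed.

Definition free_mul (p q : free_group) : free_group :=
  word_class (repr p ++ repr q).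
Definition free_inv (p : free_group) : free_group :=
  word_class (word_inv (repr p)).
Definition free_one : free_group := word_class [::].

Lemma word_class_repr u : free_equiv (repr (word_class u)) u.
Proof. by apply/word_classP; rewrite /word_class reprK. Qed.

Lemma word_class_surj (p : free_group) : exists u, p = word_class u.
Proof. by exists (repr p); rewrite /word_class reprK. Qed.

Lemma free_mulE u v :
  free_mul (word_class u) (word_class v) = word_class (u ++ v).
Proof. by apply/word_classP/free_equiv_cat; exact: word_class_repr. Qed.

Lemma free_invE u : free_inv (word_class u) = word_class (word_inv u).
Proof. by apply/word_classP/free_equiv_inv; exact: word_class_repr. Qed.

Fact free_mulA : associative free_mul.
Proof.
move=> p q r; have [u ->] := word_class_surj p.
have [v ->] := word_class_surj q; have [w ->] := word_class_surj r.
by rewrite !free_mulE catA.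
Qed.

Fact free_mul1 : left_id free_one free_mul.
Proof. by move=> p; have [u ->] := word_class_surj p; rewrite free_mulE. Qed.

Fact free_mulr1 : right_id free_one free_mul.
Proof.
by move=> p; have [u ->] := word_class_surj p; rewrite free_mulE cats0.
Qed.

Fact free_mulV : left_inverse free_one free_inv free_mul.
Proof.
move=> p; have [u ->] := word_class_surj p; rewrite free_invE free_mulE.
exact/word_classP/word_invl.
Qed.

Fact free_mulrV : right_inverse free_one free_inv free_mul.
Proof.
move=> p; have [u ->] := word_class_surj p; rewrite free_invE free_mulE.
by apply/word_classP; rewrite -{1}[u]word_invK; exact: word_invl.
Qed.

HB.instance Definition _ := isGroup.Build free_group
  free_mulA free_mul1 free_mulr1 free_mulV free_mulrV.

End FreeGroup.
Arguments word : clear implicits.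
Arguments free_group : clear implicits.

Section Presentations.
Context {X : choiceType} {G : groupType}.

Definition word_eval (f : X -> G) (w : word X) : G :=
  \prod_(l <- w) (if l.2 then (f l.1)^-1 else f l.1).

Lemma word_eval_free_equiv (f : X -> G) u v :
  free_equiv u v -> word_eval f u = word_eval f v.
Proof.
elim=> {u v} [//|//|u v w _ -> _ -> //|u v x b].
rewrite /word_eval !big_cat !big_cons /=; congr (_ * _).
by case: b; rewrite mulgA ?mulVg ?mulgV mul1g.
Qed.

(* The homomorphism from the free group on X to G which extends f. *)
Definition free_lift (f : X -> G) (p : free_group X) : G :=
  word_eval f (repr p).

Lemma free_liftE (f : X -> G) w : free_lift f (word_class w) = word_eval f w.
Proof. exact/word_eval_free_equiv/word_class_repr. Qed.

Lemma free_liftM (f : X -> G) : {morph free_lift f : p q / p * q}.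
Proof.
move=> p q; have [u ->] := word_class_surj p.
have [v ->] := word_class_surj q.
rewrite [_ * _]free_mulE !free_liftE.
by rewrite /word_eval big_cat.
Qed.

(* The family f generates G, and < X | R > is a presentation of G. *)
Definition presentation (f : X -> G) (R : set (word X)) : Prop :=
  range (free_lift f) = setT /\
  [set p | free_lift f p = 1] = normal_closure [set word_class r | r in R].

End Presentations.

Definition finitely_presented (G : groupType) : Prop :=
  exists (n : nat) (f : 'I_n -> G) (R : set (word 'I_n)),
    finite_set R /\ presentation f R.

HB.mixin Record isTopologicalGroup G of Group G & Topological G := {
  mulg_continuous : continuous (fun p : G * G => p.1 * p.2);
  invg_continuous : continuous (fun x : G => x^-1)
}.

#[short(type="topologicalGroupType")]
HB.structure Definition TopologicalGroup :=
  {G of Group G & Topological G & isTopologicalGroup G}.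

Definition locally_compact_group (G : topologicalGroupType) : Prop :=
  hausdorff_space G /\ locally_compact [set: G].

Definition tdlc_group (G : topologicalGroupType) : Prop :=
  locally_compact_group G /\ totally_disconnected [set: G].

Definition compactly_presented (G : topologicalGroupType) : Prop :=
  locally_compact_group G /\
  exists (S : set G) (N : nat) (R : set (word S)),
    [/\ compact S,
        forall r, R r -> (size r <= N)%N &
        presentation (val : S -> G) R].

Section SymmetricGroup.
Context {X : choiceType}.

(* The subspace topology coming from the topology of pointwise convergence *)
(* on X -> X, where X is discrete. *)
Definition Sym : Type :=
  set_type [set f : {ptws X -> discrete_topology X} | bijective (f : X -> X)].
HB.instance Definition _ := Topological.on Sym.

Definition sym_fun (s : Sym) : X -> X := set_val s.

Lemma sym_fun_bij (s : Sym) : bijective (sym_fun s).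
Proof. exact: (set_mem (valP s)). Qed.

Lemma sym_funP (s t : Sym) : sym_fun s =1 sym_fun t -> s = t.
Proof. by move=> st; apply/val_inj/funext. Qed.

Definition mkSym (f : X -> X) (bf : bijective f) : Sym :=
  exist (fun g : {ptws X -> discrete_topology X} => g \in _) f (mem_set bf).

Fact sym_inv_ex (s : Sym) :
  exists t, cancel (sym_fun s) (sym_fun t) /\ cancel (sym_fun t) (sym_fun s).
Proof.
have [g fK gK] := sym_fun_bij s.
by exists (mkSym (Bijective gK fK)).
Qed.

Definition sym_one : Sym := mkSym (Bijective (frefl id) (frefl id)).
Definition sym_mul (s t : Sym) : Sym :=
  mkSym (bij_comp (sym_fun_bij s) (sym_fun_bij t)).
Definition sym_inv (s : Sym) : Sym := projT1 (cid (sym_inv_ex s)).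

Lemma sym_funK s : cancel (sym_fun s) (sym_fun (sym_inv s)).
Proof. exact: (projT2 (cid (sym_inv_ex s))).1. Qed.

Lemma sym_funVK s : cancel (sym_fun (sym_inv s)) (sym_fun s).
Proof. exact: (projT2 (cid (sym_inv_ex s))).2. Qed.

Fact sym_mulA : associative sym_mul.
Proof. by move=> s t r; apply: sym_funP. Qed.
Fact sym_mul1 : left_id sym_one sym_mul.
Proof. by move=> s; apply: sym_funP. Qed.
Fact sym_mulr1 : right_id sym_one sym_mul.
Proof. by move=> s; apply: sym_funP. Qed.
Fact sym_mulV : left_inverse sym_one sym_inv sym_mul.
Proof. by move=> s; apply: sym_funP => x; exact: sym_funK. Qed.
Fact sym_mulrV : right_inverse sym_one sym_inv sym_mul.
Proof. by move=> s; apply: sym_funP => x; exact: sym_funVK. Qed.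

HB.instance Definition _ := isGroup.Build Sym
  sym_mulA sym_mul1 sym_mulr1 sym_mulV sym_mulrV.

Lemma sym_cvgP (F : set_system Sym) (s : Sym) : Filter F ->
  (F --> s) <-> (forall x, F [set t | sym_fun t x = sym_fun s x]).
Proof.
move=> FF; split=> [Fs x|Fs U].
  apply: Fs; pose Y := discrete_topology X.
  have ev : continuous (fun f : {ptws X -> Y} => f x : Y).
    exact: (@proj_continuous X (fun=> Y) x).
  have evs : continuous (fun t : Sym => sym_fun t x : Y).
    move=> t; apply: (@continuous_comp Sym {ptws X -> Y} Y set_val
      (fun f => f x) t (@initial_continuous Sym _ set_val t)).
    exact: ev.
  exact: evs s _ (@discrete_set1 Y (sym_fun s x)).
case=> _ [[W oW <-]] Ws WU.
apply: filterS WU _.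
have sF : set_val @ F --> (set_val s : {ptws X -> discrete_topology X}).
  apply/cvg_sup => x V [_ [[B oB <-]]] /= Bsx BV.
  suff : F (set_val @^-1` V) by [].
  apply: filterS (Fs x) => t tx; apply: BV.
  by rewrite /preimage /= (tx : set_val t x = _).
by apply: sF; exact: open_nbhs_nbhs.
Qed.

Fact sym_mul_continuous : continuous (fun p : Sym * Sym => p.1 * p.2).
Proof.
move=> [s t]; apply/sym_cvgP => x.
have sx := (sym_cvgP s (nbhs_filter s)).1 cvg_id (sym_fun t x).
have tx := (sym_cvgP t (nbhs_filter t)).1 cvg_id x.
exists ([set s' | sym_fun s' (sym_fun t x) = sym_fun s (sym_fun t x)],
  [set t' | sym_fun t' x = sym_fun t x]) => //.
move=> [s' t'] [/= s'E t'E].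
by rewrite [LHS](_ : _ = sym_fun s' (sym_fun t' x)) // t'E.
Qed.

Fact sym_inv_continuous : continuous (fun s : Sym => s^-1).
Proof.
move=> s; apply: (iffRL (sym_cvgP _ (fmap_filter _ (nbhs_filter s)))) => x.
have := (sym_cvgP s (nbhs_filter s)).1 cvg_id (sym_fun s^-1 x).
apply: filterS => t /=; rewrite sym_funVK => tx.
by rewrite -{1}tx sym_funK.
Qed.

HB.instance Definition _ :=
  isTopologicalGroup.Build Sym sym_mul_continuous sym_inv_continuous.

End SymmetricGroup.
Arguments Sym : clear implicits.

Section ClosedSubgroup.
Context {G : topologicalGroupType}.

Lemma subgroup_closure (H : set G) : subgroup H -> subgroup (closure H).
Proof.
move=> [/set_mem H1 HV]; split; first exact/mem_set/subset_closure.
move=> x y /set_mem Hx /set_mem Hy; apply/mem_set => U.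
have : {for (x, y), continuous (fun p : G * G => p.1 * p.2^-1)}.
  apply: (@continuous2_cvg _ _ _ _ _ _ _ _ (fun a b : G => a * b)).
  - exact: (@mulg_continuous G (x, y^-1)).
  - exact: cvg_fst.
  - apply: (@continuous_comp _ _ _ snd (fun y : G => y^-1)) => //.
      exact: cvg_snd.
    exact: invg_continuous.
move=> /[apply] -[[A B] [/= Ax By] ABU].
have [a [Ha Aa]] := Hx _ Ax; have [b [Hb Bb]] := Hy _ By.
exists (a / b); split; last exact: (ABU (a, b)).
by apply/set_mem/HV; exact/mem_set.
Qed.

End ClosedSubgroup.

Section SchlichtingCompletion.
Context {G : groupType}.
Implicit Types (L C : set G) (g h : G).

Lemma lcosetM g h C : lcoset g (lcoset h C) = lcoset (g * h) C.
Proof.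
apply/seteqP; split=> [_ [_ [x Cx <-] <-]|_ [x Cx <-]].
  by exists x; rewrite ?mulgA.
by exists (h * x); rewrite ?mulgA//; exists x.
Qed.

Lemma lcoset1 C : lcoset 1 C = C.
Proof.
by rewrite /lcoset; under eq_fun do rewrite mul1g; rewrite image_id.
Qed.

(* The coset space G/L. *)
Definition lcosets L : set (set G) := [set lcoset g L | g in [set: G]].

Fact lcoset_action_subproof L g (C : lcosets L) :
  lcoset g (set_val C) \in lcosets L.
Proof.
have [h _ hC] := set_mem (valP C); apply/mem_set.
by exists (g * h) => //; rewrite -lcosetM hC.
Qed.

Definition lcoset_action L g (C : lcosets L) : lcosets L :=
  SigSub (lcoset_action_subproof g C).

Fact lcoset_actionK L g : cancel (@lcoset_action L g) (lcoset_action g^-1).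
Proof. by move=> C; apply: val_inj; rewrite /= lcosetM mulVg lcoset1. Qed.

Fact lcoset_actionVK L g : cancel (@lcoset_action L g^-1) (lcoset_action g).
Proof. by move=> C; apply: val_inj; rewrite /= lcosetM mulgV lcoset1. Qed.

Definition lcoset_perm L g : Sym (lcosets L) :=
  mkSym (Bijective (@lcoset_actionK L g) (@lcoset_actionVK L g)).

Fact lcoset_perm_morphism L : monoid_morphism (@lcoset_perm L).
Proof.
split=> [|g h]; apply: sym_funP => C; apply: val_inj => /=.
  by rewrite lcoset1.
by rewrite -lcosetM.
Qed.

HB.instance Definition _ L :=
  isUMagmaMorphism.Build G (Sym (lcosets L)) (@lcoset_perm L)
    (lcoset_perm_morphism L).

Definition Schlichting L : Type := set_type (closure (range (@lcoset_perm L))).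

HB.instance Definition _ L := SubChoice.on (Schlichting L).
HB.instance Definition _ L := Topological.on (Schlichting L).

Fact Schlichting_group_closed L :
  group_closed (mem (closure (range (@lcoset_perm L)))).
Proof.
apply: subgroup_closure; split; first by apply/mem_set; exists 1; rewrite ?gmulf1.
move=> _ _ /set_mem[g _ <-] /set_mem[h _ <-]; apply/mem_set.
by exists (g / h); rewrite ?gmulfF.
Qed.

HB.instance Definition _ L :=
  SubChoice_isSubGroup.Build (Sym (lcosets L)) _ (Schlichting L)
    (Schlichting_group_closed L).

Fact Schlichting_mul_continuous L :
  continuous (fun p : Schlichting L * Schlichting L => p.1 * p.2).
Proof.
apply: continuous_comp_initial => -[x y].
apply: (@continuous2_cvg _ _ _ _ _ _ _ _
  (fun a b : Sym (lcosets L) => a * b)).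
- exact: (@mulg_continuous _ (val x, val y)).
- apply: (@continuous_comp _ _ _ fst (val : Schlichting L -> _)).
    exact: cvg_fst.
  exact: initial_continuous.
- apply: (@continuous_comp _ _ _ snd (val : Schlichting L -> _)).
    exact: cvg_snd.
  exact: initial_continuous.
Qed.

Fact Schlichting_inv_continuous L :
  continuous (fun x : Schlichting L => x^-1).
Proof.
apply: continuous_comp_initial => x.
apply: (@continuous_comp _ _ _ (val : Schlichting L -> _) (fun s => s^-1)).
  exact: initial_continuous.
exact: invg_continuous.
Qed.

HB.instance Definition _ L :=
  isTopologicalGroup.Build (Schlichting L)
    (@Schlichting_mul_continuous L) (@Schlichting_inv_continuous L).

End SchlichtingCompletion.

(* Main.v *)
(** Let [K] be the closure of the image of [Lambda], i.e. the stabilizer of the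
    base coset. It is open, and compact because commensuration makes its orbits
    finite. Take [S] to be [K] together with the images of the generators x_i
    of [Gamma], and as relators all words of length at most [M] that are trivial
    in the completion, with [M] large enough to include
    - the multiplication table of [K],
    - the relators of [Gamma],
    - for each generator a of [Lambda], a relation between a word in the x_i
      representing a and the letter a of [K],
    - the relations k x_i = x_i k' with k, k' in [K].
    By density every k in [K] factors as l k1 with l in [Lambda] and both k1 and
    x_i^-1 k1 x_i in [K], so modulo these relators letters of [K] can be moved
    to the right, and every word becomes g k with g a word in the x_i and k in
    [K]. If g k is trivial in the completion then g lies in the preimage of [K],
    which is [Lambda], so g equals a letter of [K] modulo the relators, and g k
    is removed by the multiplication table of [K]. *)

Require Import Defs.
From mathcomp Require Import all_boot all_classical topology.
From HB Require Import structures.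

Set Implicit Arguments.
Unset Strict Implicit.
Unset Printing Implicit Defensive.

Local Open Scope classical_set_scope.
Local Open Scope group_scope.

(** * Subgroups and congruences *)

Section Subgroups.
Context {G : groupType}.
Implicit Types (A H N : set G) (x y z : G).

Lemma subgroupP H :
  H 1 -> (forall x y, H x -> H y -> H (x * y^-1)) -> subgroup H.
Proof.
by move=> H1 HF; split=> [|x y]; rewrite ?inE //; exact: HF.
Qed.

Lemma subgroup1 H : subgroup H -> H 1.
Proof. by case=> /set_mem. Qed.

Lemma subgroupF H x y : subgroup H -> H x -> H y -> H (x * y^-1).
Proof. by case=> _ HF Hx Hy; apply/set_mem/HF; rewrite inE. Qed.

Lemma subgroupV H x : subgroup H -> H x -> H x^-1.
Proof.
by move=> sH Hx; rewrite -div1g; apply: subgroupF => //; exact: subgroup1.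
Qed.

Lemma subgroupM H x y : subgroup H -> H x -> H y -> H (x * y).
Proof.
by move=> sH Hx Hy; rewrite -[y]invgK; apply: subgroupF => //; exact: subgroupV.
Qed.

Lemma normal_subgroup_normal_closure A : normal_subgroup (normal_closure A).
Proof.
split; first apply: subgroupP.
- by move=> M [[sM _] _]; exact: subgroup1.
- move=> x y Nx Ny M sM; have [[sM' _] _] := sM.
  by apply: subgroupF => //; [exact: Nx|exact: Ny].
- by move=> g x Nx M sM; have [[_ nM] _] := sM; apply: nM; exact: Nx.
Qed.

(** For normal [N] this is equality in the quotient by [N], a group that is never formed. *)
Definition congruent N x y := N (x * y^-1).

Lemma congruent_refl N x : subgroup N -> congruent N x x.
Proof. by rewrite /congruent mulgV; exact: subgroup1. Qed.

Lemma congruent_sym N x y : subgroup N -> congruent N x y -> congruent N y x.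
Proof. by move=> sN /(subgroupV sN); rewrite invgF. Qed.

Lemma congruent_trans N y x z : subgroup N ->
  congruent N x y -> congruent N y z -> congruent N x z.
Proof.
by move=> sN xy yz; have := subgroupM sN xy yz; rewrite /congruent mulgA mulgVK.
Qed.

Lemma congruentM N x x' y y' : normal_subgroup N ->
  congruent N x x' -> congruent N y y' -> congruent N (x * y) (x' * y').
Proof.
move=> [sN nN] xx' /(nN x) Ny; apply: (@congruent_trans _ (x * y')) => //.
  by move: Ny; rewrite /congruent invgM !mulgA.
by rewrite /congruent invgM !mulgA mulgK.
Qed.

Lemma congruentV N x y : normal_subgroup N ->
  congruent N x y -> congruent N x^-1 y^-1.
Proof.
move=> [sN nN] xy; have := nN x^-1 _ (congruent_sym sN xy).
by rewrite /congruent !invgK !mulgA mulgVK.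
Qed.

End Subgroups.

(** * Words and free groups *)

Section Words.
Context {X : choiceType}.
Implicit Types (G H : groupType) (u v w : word X).

Lemma word_eval0 G (f : X -> G) : word_eval f [::] = 1.
Proof. by rewrite /word_eval big_nil. Qed.

Lemma word_eval_cons G (f : X -> G) x b w :
  word_eval f ((x, b) :: w) = (if b then (f x)^-1 else f x) * word_eval f w.
Proof. by rewrite /word_eval big_cons. Qed.

Lemma word_eval_cat G (f : X -> G) u v :
  word_eval f (u ++ v) = word_eval f u * word_eval f v.
Proof. by rewrite /word_eval big_cat. Qed.

Lemma word_eval_inv G (f : X -> G) w :
  word_eval f (word_inv w) = (word_eval f w)^-1.
Proof.
apply/(mulIg (word_eval f w)); rewrite mulVg -word_eval_cat.
by rewrite (word_eval_free_equiv f (word_invl w)) word_eval0.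
Qed.

Lemma word_eval_map {Y : choiceType} G (f : Y -> G) (s : X -> Y) w :
  word_eval f [seq (s l.1, l.2) | l <- w] = word_eval (f \o s) w.
Proof. by rewrite /word_eval big_map. Qed.

Lemma word_eval_morph G H (g : UMagmaMorphism.type G H) (f : X -> G) w :
  g (word_eval f w) = word_eval (g \o f) w.
Proof.
rewrite /word_eval gmulf_prod; apply: eq_bigr => -[x b] _ /=.
by case: b; rewrite ?gmulfV.
Qed.

Definition free_gen (x : X) : free_group X := word_class [:: (x, false)].

Lemma word_classE w : word_class w = word_eval free_gen w.
Proof.
elim: w => [|[x b] w IH]; first by rewrite word_eval0.
rewrite word_eval_cons -IH -cat1s -free_mulE; congr (_ * _).
by case: b => //; rewrite /free_gen [RHS]free_invE.
Qed.

Fact free_lift_monoid_morphism G (f : X -> G) :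
  monoid_morphism (free_lift f).
Proof.
split; last exact: free_liftM.
by rewrite [1]/(word_class [::]) free_liftE word_eval0.
Qed.

HB.instance Definition _ G (f : X -> G) :=
  isUMagmaMorphism.Build (free_group X) G (free_lift f)
    (free_lift_monoid_morphism f).

End Words.

Lemma preim_normal_subgroup (G H : groupType) (g : UMagmaMorphism.type G H) N :
  normal_subgroup N -> normal_subgroup (g @^-1` N).
Proof.
move=> [sN nN]; split=> [|x y /= Ny]; last by rewrite !gmulfM gmulfV; exact: nN.
apply: subgroupP => [|x y Nx Ny] /=; first by rewrite gmulf1; exact: subgroup1.
by rewrite gmulfF; exact: subgroupF.
Qed.

Lemma normal_subgroup1 (G : groupType) : normal_subgroup [set 1 : G].
Proof.
split=> [|g x ->]; last by rewrite mulg1 mulgV.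
by apply: subgroupP => // x y -> ->; rewrite mulgV.
Qed.

(** * A presentation with bounded relators *)

(** Von Dyck's argument: the preimage of [N] under [free_lift h] is normal and contains the
    relators, hence contains the kernel of [free_lift f]. *)
Lemma presentation_ker (I X : choiceType) (Gamma H : groupType)
    (f : I -> Gamma) R (h : I -> H) N w :
  presentation f R -> normal_subgroup N ->
  (forall r, R r -> N (word_eval h r)) -> word_eval f w = 1 ->
  N (word_eval h w).
Proof.
move=> [_ kerf] nN RN fw.
have : normal_closure [set word_class r | r in R] (word_class w).
  by rewrite -kerf /= free_liftE.
rewrite -free_liftE => /(_ (free_lift h @^-1` N)); apply.
split; first exact: preim_normal_subgroup.
by move=> _ [r Rr <-] /=; rewrite free_liftE; exact: RN.
Qed.

Lemma presentation_rel (I : choiceType) (Gamma : groupType)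
    (f : I -> Gamma) R r :
  presentation f R -> R r -> word_eval f r = 1.
Proof.
move=> [_ kerf] Rr; have : [set p | free_lift f p = 1] (word_class r).
  by rewrite kerf => N [_]; apply; exists r.
by rewrite /= free_liftE.
Qed.

Lemma presentation_surj (I : choiceType) (Gamma : groupType)
    (f : I -> Gamma) R g :
  presentation f R -> exists w, word_eval f w = g.
Proof.
move=> [surjf _]; have [p _ <-] : range (free_lift f) g by rewrite surjf.
by have [w ->] := word_class_surj p; exists w; rewrite free_liftE.
Qed.

Lemma finite_set_bounded (T : choiceType) (A : set T) (F : T -> nat) :
  finite_set A -> exists M, forall x, A x -> (F x <= M)%N.
Proof.
move=> /finite_seqP[s ->]; exists (\max_(x <- s) F x) => x /= xs.
exact: leq_bigmax_seq.
Qed.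

Section BoundedPresentation.
Context {Gamma G : groupType} {phi : UMagmaMorphism.type Gamma G}.
Context {I : choiceType} {f : I -> Gamma} {R0 : set (word I)}.
Hypothesis fR0 : presentation f R0.
Hypothesis finR0 : finite_set R0.
Context {L A : set Gamma}.
Hypothesis finA : finite_set A.
Hypothesis LE : L = generated A.
Context {K : set G}.
Hypothesis sK : subgroup K.
Hypothesis phiK : forall g, K (phi g) <-> L g.
Hypothesis G_factor : forall x, exists g k, K k /\ x = phi g * k.
(** Density in algebraic form: in the application [l] imitates [k] at the base coset and at its
    translate by [g], so that the correction [k'] fixes both. *)
Hypothesis K_factor : forall k g, K k ->
  exists l k', [/\ L l, K k', k = phi l * k' & K ((phi g)^-1 * k' * phi g)].

Let S : set G := K `|` range (phi \o f).

Let one : S := exist _ 1 (mem_set (or_introl (subgroup1 sK))).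
(* The junk value [one] is taken outside [S]. *)
Let letter (x : G) : S := insubd one x.
Let kgen x : free_group S := free_gen (letter x).
(** Letters are elements of [S]: a generator whose image lies in [K] is the same letter as that
    element of [K]. *)
Let fgen i : free_group S := kgen (phi (f i)).

Let letterE x : S x -> val (letter x) = x.
Proof. by move=> Sx; rewrite val_insubd mem_set. Qed.

Let letterK x : K x -> val (letter x) = x.
Proof. by move=> Kx; apply: letterE; left. Qed.

Let letterf i : val (letter (phi (f i))) = phi (f i).
Proof. by apply: letterE; right; exists i. Qed.

Let fgenE w :
  word_eval fgen w = word_class [seq (letter (phi (f l.1)), l.2) | l <- w].
Proof.
by rewrite word_classE (@word_eval_map _ _ _ _ (letter \o phi \o f)).
Qed.

Let val_fgen w :
  word_eval val [seq (letter (phi (f l.1)), l.2) | l <- w]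
  = phi (word_eval f w).
Proof.
rewrite (@word_eval_map _ _ _ _ (letter \o phi \o f)) word_eval_morph.
by congr (word_eval _ w); apply/funext => i /=; exact: letterf.
Qed.

(** * Rewriting modulo the short relators *)

Section Relations.
Context {N : set (free_group S)} {M : nat}.
Hypothesis nN : normal_subgroup N.
(** The relations [k x = x k'] take four letters, the multiplication table of [K] three. *)
Hypothesis M4 : (4 <= M)%N.
Hypothesis R0M : forall r, R0 r -> (size r <= M)%N.
(** The strict bound leaves room for the one letter of [K] that [w] is equated with. *)
Hypothesis AM : forall a, A a ->
  exists2 w, word_eval f w = a & (size w < M)%N.
Hypothesis MN : forall r : word S,
  (size r <= M)%N -> word_eval val r = 1 -> N (word_class r).

Let sN : subgroup N := nN.1.

Let congruent_word u v : (size u + size v <= M)%N ->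
  word_eval (val : S -> G) u = word_eval val v ->
  congruent N (word_class u) (word_class v).
Proof.
move=> uvM uv; rewrite /congruent.
have -> : (word_class v)^-1 = word_class (word_inv v) by exact: free_invE.
rewrite [_ * _]free_mulE; apply: MN.
  by rewrite size_cat /word_inv size_rev size_map.
by rewrite word_eval_cat word_eval_inv uv mulgV.
Qed.

Let congruent_kgenM x y : K x -> K y ->
  congruent N (kgen x * kgen y) (kgen (x * y)).
Proof.
move=> Kx Ky; rewrite [_ * _]free_mulE.
apply: congruent_word; first exact: leq_trans M4.
rewrite !word_eval_cons !word_eval0 !mulg1.
by rewrite !letterK //; exact: subgroupM.
Qed.

Let congruent_kgen1 : congruent N (kgen 1) 1.
Proof.
apply: (@congruent_word _ [::]); first exact: leq_trans M4.
by rewrite !word_eval_cons !word_eval0 !mulg1 letterK //; exact: subgroup1.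
Qed.

Let congruent_kgenV x : K x -> congruent N (kgen x)^-1 (kgen x^-1).
Proof.
move=> Kx; have Kx' := subgroupV sK Kx.
have -> : (kgen x)^-1 = word_class [:: (letter x, true)] by exact: free_invE.
apply: congruent_word; first exact: leq_trans M4.
by rewrite !word_eval_cons !word_eval0 !mulg1 !letterK.
Qed.

Let congruent_conj i (b : bool) k k' : K k -> K k' ->
  let x := if b then (f i)^-1 else f i in
  k * phi x = phi x * k' ->
  congruent N (kgen k * word_eval fgen [:: (i, b)])
              (word_eval fgen [:: (i, b)] * kgen k').
Proof.
move=> Kk Kk' x kx; rewrite fgenE /= ![_ * _]free_mulE.
apply: congruent_word => //; rewrite !word_eval_cons !word_eval0 !mulg1.
rewrite letterf (letterK Kk) (letterK Kk'); move: kx; rewrite /x.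
by case: b {x} => //; rewrite gmulfV.
Qed.

Let fgen_kernel w : word_eval f w = 1 -> N (word_eval fgen w).
Proof.
apply: presentation_ker fR0 nN _ => // r Rr.
rewrite fgenE; apply: MN; first by rewrite size_map; exact: R0M.
by rewrite val_fgen (presentation_rel fR0 Rr) gmulf1.
Qed.

(** Induction over [L] as generated by [A]: [P] holds on [A] by the short relations, and passes to
    [x * y^-1] by the multiplication table of [K]. *)
Let fgen_Lambda w : L (word_eval f w) ->
  congruent N (word_eval fgen w) (kgen (phi (word_eval f w))).
Proof.
pose P l := L l /\ forall w, word_eval f w = l ->
  congruent N (word_eval fgen w) (kgen (phi l)).
suff LP : L `<=` P by move=> /LP[_]; apply.
(* One spelling of [l] suffices: two spellings differ by an element of [N], by [fgen_kernel]. *)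
have PP l w' : L l -> word_eval f w' = l ->
    congruent N (word_eval fgen w') (kgen (phi l)) -> P l.
  move=> Ll w'l w'k; split=> // w0 w0l; apply: congruent_trans w'k => //.
  rewrite /congruent -word_eval_inv -word_eval_cat; apply: fgen_kernel.
  by rewrite word_eval_cat word_eval_inv w0l w'l mulgV.
rewrite {1}LE; apply: smallest_sub => [|a Aa].
  apply: subgroupP => [|x y [Lx Px] [Ly Py]].
    apply: (@PP _ [::]); rewrite ?word_eval0 //.
      by apply/phiK; rewrite gmulf1; exact: subgroup1.
    by rewrite gmulf1; apply: congruent_sym.
  have [u ux] := presentation_surj x fR0.
  have [v vy] := presentation_surj y fR0.
  have Kx : K (phi x) by apply/phiK.
  have Ky : K (phi y) by apply/phiK.
  have Ky' : K (phi y)^-1 by exact: subgroupV.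
  apply: (@PP _ (u ++ word_inv v)).
  - by apply/phiK; rewrite gmulfF; exact: subgroupF.
  - by rewrite word_eval_cat word_eval_inv ux vy.
  - rewrite word_eval_cat word_eval_inv gmulfF.
    apply: congruent_trans (congruent_kgenM Kx Ky') => //.
    apply: congruentM => //; first exact: Px.
    apply: congruent_trans (congruent_kgenV Ky) => //.
    by apply: congruentV => //; exact: Py.
have [w' w'a sw'] := AM Aa.
have La : L a by rewrite LE => B [_]; exact.
apply: (PP _ w') => //; rewrite fgenE; apply: congruent_word.
  by rewrite size_map addn1.
rewrite val_fgen w'a word_eval_cons word_eval0 mulg1 letterK //.
exact/phiK.
Qed.

(** At each letter [k] is split as [phi l * k1]; [l] is spelled out on the left, and [k1] crosses
    the letter as its conjugate [k2]. The splitting is needed because conjugation by the letter may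
    take [k] itself out of [K]. *)
Let kgen_fgen k w : K k ->
  exists k' w', K k' /\
    congruent N (kgen k * word_eval fgen w) (word_eval fgen w' * kgen k').
Proof.
elim: w k => [|[i b] w IH] k Kk.
  exists k, [::]; rewrite word_eval0 mulg1 mul1g; split=> //.
  exact: congruent_refl.
pose x := if b then (f i)^-1 else f i.
have [l [k1 [Ll Kk1 kE Kk2]]] := K_factor x Kk; set k2 := _ * _ in Kk2.
have [wl wlE] := presentation_surj l fR0.
have Kl : K (phi l) by apply/phiK.
have [k' [w' [Kk' kw']]] := IH k2 Kk2.
exists k', (wl ++ (i, b) :: w'); split=> //.
rewrite -(cat1s _ w) -(cat1s _ w') !word_eval_cat.
have c1 : congruent N (kgen k) (word_eval fgen wl * kgen k1).
  rewrite kE; apply: (@congruent_trans _ _ (kgen (phi l) * kgen k1)) => //.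
    by apply: congruent_sym => //; exact: congruent_kgenM.
  apply: congruentM => //; last exact: congruent_refl.
  by apply: congruent_sym => //; rewrite -wlE; apply: fgen_Lambda; rewrite wlE.
have c2 : congruent N (kgen k1 * word_eval fgen [:: (i, b)])
    (word_eval fgen [:: (i, b)] * kgen k2).
  by apply: congruent_conj => //; rewrite -/x /k2 !mulgA mulgV mul1g.
rewrite mulgA; set a := word_eval fgen [:: (i, b)] in c2 *.
apply: (@congruent_trans _ _
  (word_eval fgen wl * (kgen k1 * a) * word_eval fgen w)) => //.
  rewrite mulgA; apply: congruentM => //; last exact: congruent_refl.
  by apply: congruentM => //; exact: congruent_refl.
apply: (@congruent_trans _ _
  (word_eval fgen wl * (a * kgen k2) * word_eval fgen w)) => //.
  apply: congruentM => //; last exact: congruent_refl.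
  by apply: congruentM => //; exact: congruent_refl.
rewrite -!mulgA; apply: congruentM => //; first exact: congruent_refl.
by apply: congruentM => //; first exact: congruent_refl.
Qed.

Let normal_form p : exists k w, K k /\
  congruent N p (word_eval fgen w * kgen k).
Proof.
have [u ->] := word_class_surj p; rewrite word_classE.
elim: u => [|[x b] u [k [w [Kk IH]]]].
  exists 1, [::]; split; first exact: subgroup1.
  by rewrite !word_eval0 mul1g; apply: congruent_sym.
rewrite word_eval_cons.
(* A letter from [K], with its sign absorbed into [y'], is moved past [w] and merged with [k]. *)
have Klet y : K y -> letter y = x -> exists k' w', K k' /\
    congruent N
      ((if b then (free_gen x)^-1 else free_gen x) * word_eval free_gen u)
      (word_eval fgen w' * kgen k').
  move=> Ky yx; pose y' := if b then y^-1 else y.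
  have Ky' : K y' by rewrite /y'; case: (b) => //; exact: subgroupV.
  have [k' [w' [Kk' E]]] := kgen_fgen w Ky'.
  exists (k' * k), w'; split; first exact: subgroupM.
  apply: (@congruent_trans _ _ (kgen y' * (word_eval fgen w * kgen k))) => //.
    apply: congruentM => //; rewrite /y' -yx; case: (b).
      exact: congruent_kgenV.
    exact: congruent_refl.
  rewrite mulgA.
  apply: (@congruent_trans _ _ (word_eval fgen w' * kgen k' * kgen k)) => //.
    by apply: congruentM => //; exact: congruent_refl.
  rewrite -mulgA; apply: congruentM => //; first exact: congruent_refl.
  exact: congruent_kgenM.
have [Kx|[i _ fix_]] : S (val x) := set_mem (valP x).
  apply: (Klet (val x)) => //; exact: valKd.
(* A letter that is the image of a generator of [Gamma] just extends [w]. *)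
exists k, ((i, b) :: w); split => //.
have -> : free_gen x = fgen i by rewrite /fgen /kgen [phi _]fix_ /letter valKd.
rewrite word_eval_cons -mulgA; apply: congruentM => //.
exact: congruent_refl.
Qed.

Lemma kernel_sub_normal
    (NG : forall p, N p -> free_lift (val : S -> G) p = 1) p :
  free_lift (val : S -> G) p = 1 -> N p.
Proof.
move=> p1; have [k [w [Kk pE]]] := normal_form p.
(* [NG], applied to the quotient of [p] by its normal form, shows that the normal form is trivial in
   [G] as well. *)
have wk : phi (word_eval f w) * k = 1.
  apply: invg_inj; rewrite invg1 -(NG _ pE) gmulfF /= p1 mul1g gmulfM /=.
  by rewrite fgenE !free_liftE val_fgen word_eval_cons word_eval0 mulg1 letterK.
have Kw : K (phi (word_eval f w)).
  by rewrite -[phi _]invgK (mulg1_eq wk); exact: subgroupV.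
suff : congruent N p 1 by rewrite /congruent divg1.
apply: (congruent_trans sN pE).
apply: (@congruent_trans _ _ (kgen (phi (word_eval f w)) * kgen k)) => //.
  apply: congruentM => //; last exact: congruent_refl.
  by apply: fgen_Lambda; exact/phiK.
by apply: (congruent_trans sN (congruent_kgenM Kw Kk)); rewrite wk.
Qed.

End Relations.

(** * Choice of the length bound *)

Lemma bounded_presentation : exists (M : nat) (R : set (word S)),
  (forall r, R r -> (size r <= M)%N) /\ presentation (val : S -> G) R.
Proof.
have [wA wAE] := choice (fun a => presentation_surj a fR0).
have [M1 M1P] := finite_set_bounded (fun r : word I => size r) finR0.
have [M2 M2P] := finite_set_bounded (fun a => size (wA a)) finA.
(* Room for the relations of [K], the relators of [Gamma] and the spellings of [A]; the summand 4
   also makes the last bound strict. *)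
pose M := (4 + M1 + M2)%N.
exists M, [set r | (size r <= M)%N /\ word_eval val r = 1].
split=> [r []//|]; split.
  apply/seteqP; split=> // x _; have [g [k [Kk ->]]] := G_factor x.
  have [w <-] := presentation_surj g fR0.
  exists (word_eval fgen w * kgen k) => //.
  rewrite gmulfM /= fgenE !free_liftE val_fgen word_eval_cons word_eval0 mulg1.
  by rewrite letterK.
set R := [set r | _]; set N := normal_closure _.
have NG : N `<=` [set p | free_lift (val : S -> G) p = 1].
  apply: smallest_sub => [|_ [r [_ r1] <-]]; last by rewrite /= free_liftE.
  exact: (@preim_normal_subgroup _ _ (free_lift (val : S -> G)) _
    (normal_subgroup1 G)).
apply/seteqP; split=> // p.
apply: (@kernel_sub_normal N M) => //.
- exact: normal_subgroup_normal_closure.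
- by move=> r /M1P rM; rewrite /M addnAC (leq_trans rM) // leq_addl.
- move=> a /M2P aM; exists (wA a) => //.
  by rewrite /M -addnA addSn ltnS (leq_trans aM) // addnA leq_addl.
- by move=> r rM r1; apply: sub_gen_smallest; exists r.
Qed.

End BoundedPresentation.

(** * The Schlichting completion *)

Lemma ultra_finite (T U : Type) (F : set_system T) (f : T -> U) (A : set U) :
  UltraFilter F -> finite_set A -> F (f @^-1` A) ->
  exists2 y, A y & F [set t | f t = y].
Proof.
move=> FU /finite_setP[n]; elim: n A => [|n IH] A.
  rewrite II0 card_eq0 => /eqP ->; rewrite preimage_set0 => F0.
  by have /(_ _ F0) := @filter_not_empty T F.
move=> /eq_cardSP[y Ay cA] FA.
have [Fy|Fy] := in_ultra_setVsetC [set t | f t = y] FU.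
  by exists y.
have [|z [Az _] Fz] := IH _ cA; last by exists z.
by apply: filterS (filterI FA Fy) => t [].
Qed.

Lemma zero_dimensional_hausdorff (T : topologicalType) :
  zero_dimensional T -> hausdorff_space T.
Proof.
move=> zT; rewrite open_hausdorff => x y /zT[U [[oU cU] Ux Uy]].
exists (U, ~` U); rewrite ?inE //=.
by split=> //; [rewrite openC|rewrite setICr].
Qed.

Section Schlichting.
Context {Gamma : groupType} {L : set Gamma}.
Local Notation G := (Schlichting L).
Local Notation X := (lcosets L).
Implicit Types (s t : G) (x y : X).

Definition schlichting_fun s : X -> X := sym_fun (val s).

Lemma schlichting_funM s t x :
  schlichting_fun (s * t) x = schlichting_fun s (schlichting_fun t x).
Proof. by []. Qed.

Lemma schlichting_funK s : cancel (schlichting_fun s) (schlichting_fun s^-1).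
Proof. by move=> x; rewrite -schlichting_funM mulVg. Qed.

(** The coset space is discrete, so convergence at a coset means eventual equality there; [sym_cvgP]
    is transported along the inclusion into [Sym X]. *)
Lemma schlichting_cvgP (F : set_system G) s : Filter F ->
  F --> s <-> (forall x, F [set t | schlichting_fun t x = schlichting_fun s x]).
Proof.
move=> FF; split=> [Fs|Fs U].
  apply/(sym_cvgP (val s) (fmap_filter (val : G -> Sym X) FF)).
  exact: cvg_comp Fs (@initial_continuous _ _ (val : G -> Sym X) s).
case=> _ [[W oW <-]] Ws WU.
apply: filterS WU _.
have : (val : G -> Sym X) @ F --> (val s : Sym X).
  exact/(sym_cvgP (val s) (fmap_filter (val : G -> Sym X) FF)).
by apply; exact: open_nbhs_nbhs.
Qed.

Lemma nbhs_schlichting_fun s x :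
  nbhs s [set t | schlichting_fun t x = schlichting_fun s x].
Proof. exact: (schlichting_cvgP s (nbhs_filter s)).1. Qed.

Lemma clopen_schlichting_fun x y : clopen [set s | schlichting_fun s x = y].
Proof.
split.
  rewrite openE => s <-; exact: nbhs_schlichting_fun.
rewrite -openC openE => s /= sy.
by apply: filterS (nbhs_schlichting_fun s x) => t /= ->.
Qed.

Lemma schlichting_funP s t : schlichting_fun s =1 schlichting_fun t -> s = t.
Proof. by move=> st; apply: val_inj; exact: sym_funP. Qed.

Lemma zero_dimensional_schlichting : zero_dimensional G.
Proof.
move=> s t st.
have [x sx] : exists x, schlichting_fun s x <> schlichting_fun t x.
  by apply/existsNP => E; move/eqP: st; apply; exact: schlichting_funP.
exists [set u | schlichting_fun u x = schlichting_fun s x]; split => //.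
  exact: clopen_schlichting_fun.
by move=> /= /esym.
Qed.

(** * The dense image of [Gamma] and the stabilizer of the base coset *)

Fact schlichting_emb_subproof g :
  lcoset_perm L g \in closure (range (@lcoset_perm _ L)).
Proof. by apply/mem_set/subset_closure; exists g. Qed.

Definition schlichting_emb g : G := SigSub (schlichting_emb_subproof g).

Fact schlichting_emb_monoid_morphism : monoid_morphism schlichting_emb.
Proof.
by split=> [|g h]; apply: val_inj => /=; rewrite ?gmulf1 ?gmulfM.
Qed.

HB.instance Definition _ :=
  isUMagmaMorphism.Build Gamma G schlichting_emb
    schlichting_emb_monoid_morphism.

Lemma schlichting_embE g x :
  schlichting_fun (schlichting_emb g) x = lcoset_action g x.
Proof. by []. Qed.

(** Agreement with [s] at both points defines a neighbourhood of [s], which the dense image of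
    [Gamma] meets. *)
Lemma schlichting_emb_dense2 s x y : exists g,
  schlichting_fun s x = lcoset_action g x /\
  schlichting_fun s y = lcoset_action g y.
Proof.
have := set_mem (valP s).
have nx := (sym_cvgP (val s) (nbhs_filter (val s))).1 cvg_id.
move=> /(_ _ (filterI (nx x) (nx y)))[_ [[g _ <-] /= [gx gy]]].
by exists g.
Qed.

Lemma lcoset_actionE g x : set_val (lcoset_action g x) = lcoset g (set_val x).
Proof. by []. Qed.

Fact base_coset_subproof : lcoset 1 L \in lcosets L.
Proof. by apply/mem_set; exists 1. Qed.

Definition base_coset : X := SigSub base_coset_subproof.

Lemma base_cosetE : set_val base_coset = L.
Proof. exact: lcoset1. Qed.

Definition schlichting_stab : set G :=
  [set s | schlichting_fun s base_coset = base_coset].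

Lemma subgroup_schlichting_stab : subgroup schlichting_stab.
Proof.
apply: subgroupP => // s t sK tK; rewrite /schlichting_stab /= schlichting_funM.
by rewrite -{1}tK schlichting_funK.
Qed.

Hypothesis sL : subgroup L.

Lemma schlichting_stab_emb g : schlichting_stab (schlichting_emb g) <-> L g.
Proof.
rewrite /schlichting_stab /= schlichting_embE; split=> [/(congr1 val) /=|Lg].
  rewrite lcoset1 base_cosetE => gL; rewrite -gL; exists 1; rewrite ?mulg1 //.
  exact: subgroup1.
apply: val_inj; rewrite /= lcoset1 base_cosetE; apply/seteqP.
split=> [_ [x Lx <-]|x Lx].
  exact: subgroupM.
exists (g^-1 * x); last by rewrite mulgA mulgV mul1g.
by apply: subgroupM => //; exact: subgroupV.
Qed.

Lemma coset_rep x : exists g, x = lcoset_action g base_coset.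
Proof.
have [g _ gx] := set_mem (valP x); exists g; apply: val_inj.
by rewrite -gx /= base_cosetE.
Qed.

Lemma schlichting_factor s :
  exists g k, schlichting_stab k /\ s = schlichting_emb g * k.
Proof.
have [g [sg _]] := schlichting_emb_dense2 s base_coset base_coset.
exists g, ((schlichting_emb g)^-1 * s); split.
  rewrite /schlichting_stab /= schlichting_funM sg -schlichting_embE.
  exact: schlichting_funK.
by rewrite mulgA mulgV mul1g.
Qed.

(** Take [l] imitating [k] at the base coset and at [y]. Then [l] fixes the base coset because [k]
    does, and [k' = l^-1 k] fixes both points; fixing [y] is the conjugated condition. *)
Lemma schlichting_stab_factor k g : schlichting_stab k ->
  exists l k', [/\ L l, schlichting_stab k', k = schlichting_emb l * k' &
    schlichting_stab ((schlichting_emb g)^-1 * k' * schlichting_emb g)].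
Proof.
move=> Kk; pose y := lcoset_action g base_coset.
have [l [kl kly]] := schlichting_emb_dense2 k base_coset y.
exists l, ((schlichting_emb l)^-1 * k); split; last 2 first.
- by rewrite mulgA mulgV mul1g.
- rewrite /schlichting_stab /= !schlichting_funM (schlichting_embE g) -/y kly.
  rewrite -schlichting_embE schlichting_funK /y -schlichting_embE.
  exact: schlichting_funK.
- apply/schlichting_stab_emb.
  by rewrite /schlichting_stab /= schlichting_embE -kl.
- rewrite /schlichting_stab /= schlichting_funM kl -schlichting_embE.
  exact: schlichting_funK.
Qed.

(** * Compactness of the stabilizer and local compactness *)

Hypothesis cL : commensurated L.

(** By density the orbit of [gL] is already its orbit under [L], and [hgL] depends only on the coset
    of [h] modulo the intersection of [gLg^-1] and [L], which has finite index in [L]. *)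
Lemma schlichting_stab_orbit_finite x :
  finite_set [set schlichting_fun k x | k in schlichting_stab].
Proof.
have [g ->] := coset_rep x; have [fin _] := cL g.
(* If [C] is the coset of [h] modulo that intersection, then [translate C] is [hgL]. *)
pose translate (C : set Gamma) : set Gamma :=
  [set c * g * l | c in C & l in L].
have := finite_preimage (f := set_val : X -> set Gamma)
  (in2W val_inj) (finite_image translate fin).
apply: sub_finite_set => _ [k Kk <-].
have [h [hx hg]] :=
  schlichting_emb_dense2 k base_coset (lcoset_action g base_coset).
have Lh : L h.
  apply/schlichting_stab_emb.
  by rewrite /schlichting_stab /= schlichting_embE -hx.
exists (lcoset h (conj_set g L `&` L)); first by exists h.
rewrite hg !lcoset_actionE base_cosetE lcosetM; apply/seteqP.
split=> [_ [_ [c [[z Lz <-] _] <-] [l Ll <-]]|_ [l Ll <-]].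
  exists (z * l); first exact: subgroupM.
  by rewrite !mulgA mulgVK.
exists h; last by exists l.
exists 1; last by rewrite mulg1.
split; last exact: subgroup1.
by exists 1; [exact: subgroup1|rewrite mulg1 mulgV].
Qed.

(** Orbits being finite, an ultrafilter on the stabilizer is eventually constant at each coset;
    these constants form its limit. *)
Lemma compact_schlichting_stab : compact schlichting_stab.
Proof.
rewrite compact_ultra => F FU FK.
have /choice[f fE] : forall x, exists y, F [set s | schlichting_fun s x = y].
  move=> x; have [|y _ Fy] := ultra_finite FU (schlichting_stab_orbit_finite x)
    (f := fun s => schlichting_fun s x).
    by apply: filterS FK => s sK; exists s.
  by exists y.
(* The limits of the inverses along [F] show that the pointwise limit of [F] is
   a bijection. *)
have /choice[f' f'E] :
    forall x, exists y, F [set s | schlichting_fun s^-1 x = y].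
  move=> x; have [|y _ Fy] := ultra_finite FU (schlichting_stab_orbit_finite x)
    (f := fun s => schlichting_fun s^-1 x).
    apply: filterS FK => s sK; exists s^-1 => //.
    exact: (subgroupV subgroup_schlichting_stab).
  by exists y.
have fK : cancel f f'.
  move=> x; have [s [/= sx <-]] := filter_ex (filterI (fE x) (f'E (f x))).
  by rewrite -sx schlichting_funK.
have f'K : cancel f' f.
  move=> x; have [s [/= sx <-]] := filter_ex (filterI (f'E x) (fE (f' x))).
  by rewrite -sx -{1}[s]invgK schlichting_funK.
pose lim : Sym X := mkSym (Bijective fK f'K).
have Flim : (val : G -> Sym X) @ F --> lim.
  by apply/(sym_cvgP lim (fmap_filter (val : G -> Sym X) _)) => x; exact: fE.
have Gl : lim \in closure (range (@lcoset_perm _ L)).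
  apply/mem_set; apply: (@closed_cvg _ _ F _ (val : G -> Sym X) _ _ _ _ Flim).
  - exact: closed_closure.
  - by apply: nearW => s; exact: (set_mem (valP s)).
exists (SigSub Gl : G); split; last exact/schlichting_cvgP.
(* The limit agrees at the base coset with some element of the stabilizer. *)
have [s [sK fs]] := filter_ex (filterI FK (fE base_coset)).
exact: etrans (esym fs) sK.
Qed.
(** The elements agreeing with [s] at the base coset form a closed neighbourhood of [s], which is
    the translate of the compact stabilizer by [s]. *)
Lemma locally_compact_schlichting : locally_compact [set: G].
Proof.
move=> s _; have [_ clS] :=
  clopen_schlichting_fun base_coset (schlichting_fun s base_coset).
exists [set t | schlichting_fun t base_coset = schlichting_fun s base_coset].
  by apply: filterS (nbhs_schlichting_fun s base_coset).
split=> //.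
rewrite [X in compact X](_ : _ = (fun t => s * t) @` schlichting_stab).
  apply: continuous_compact compact_schlichting_stab.
  apply: continuous_subspaceT => t.
  apply: (iffRL (schlichting_cvgP _ (fmap_filter _ (nbhs_filter t)))) => x.
  apply: filterS (nbhs_schlichting_fun t x) => t' /= t'x.
  by rewrite !schlichting_funM t'x.
apply/seteqP; split=> [t /= ts|_ [t tK <-] /=].
  exists (s^-1 * t); last by rewrite mulgA mulgV mul1g.
  by rewrite /schlichting_stab /= schlichting_funM ts schlichting_funK.
by rewrite schlichting_funM tK.
Qed.

End Schlichting.

Theorem theorem6p1 (Gamma : groupType) (Lambda : set Gamma)
    (Gamma_fp : finitely_presented Gamma)
    (Lambda_subgroup : subgroup Lambda)
    (Lambda_fg : finitely_generated Lambda)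
    (Lambda_comm : commensurated Lambda) :
  tdlc_group (Schlichting Lambda) /\ compactly_presented (Schlichting Lambda).
Proof.
have lc : locally_compact_group (Schlichting Lambda).
  split; last exact: locally_compact_schlichting.
  exact: zero_dimensional_hausdorff zero_dimensional_schlichting.
split.
  split=> //.
  exact: zero_dimension_totally_disconnected zero_dimensional_schlichting.
split=> //.
have [n [f [R0 [finR0 fR0]]]] := Gamma_fp; have [A finA LE] := Lambda_fg.
have [N [R [RN presR]]] := bounded_presentation fR0 finR0 finA LE
  subgroup_schlichting_stab (schlichting_stab_emb Lambda_subgroup)
  schlichting_factor (schlichting_stab_factor Lambda_subgroup).
exists (schlichting_stab `|` range (schlichting_emb \o f)), N, R; split=> //.
(* [f] has a finite index type, so only finitely many points are added to the compact stabilizer. *)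
apply: compactU; first exact: compact_schlichting_stab.
exact/finite_compact/finite_image/finite_finset.
Qed.
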